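(* Let $\mathcal{G}$ be a linear nested sequent. If $\mathcal{G}$ is valid, then $\mathcal{G}$ has a non-wellfounded proof (an $\mathsf{LNS^{\infty}_{LTL}}$-proof) satisfying the saturation recurrence property.
   Context: **Language and semantics.** Let $\mathsf{Atm}$ be a denumerable set of atoms. Formulae of $\mathscr{L}$ are given by $A,B ::= p \mid \bot \mid (A \to B) \mid \mathtt{X} A \mid (A \,\mathtt{U}\, B)$ with $p \in \mathsf{Atm}$; $\neg A := A \to \bot$, $A \lor B := \neg A \to B$, $A \land B := \neg(A \to \neg B)$. A state sequence is an infinite sequence $\bar\sigma = (\sigma_0,\sigma_1,\ldots)$ with each $\sigma_i \subseteq \mathsf{Atm}$. Satisfaction at $i \ge 0$: $\bar\sigma,i \vDash p$ iff $p \in \sigma_i$; $\bar\sigma,i\not\vDash\bot$; $\bar\sigma,i\vDash A\to B$ iff $\bar\sigma,i\not\vDash A$ or $\bar\sigma,i\vDash B$; $\bar\sigma,i\vDash \mathtt{X}A$ iff $\bar\sigma,i+1\vDash A$; $\bar\sigma,i\vDash A\,\mathtt{U}\,B$ iff there is $j\ge i$ with $\bar\sigma,j\vDash B$ and $\bar\sigma,n\vDash A$ for all $i\le n<j$. $\bar\sigma\vDash A$ means $\bar\sigma,0\vDash A$; $A$ is valid iff $\bar\sigma\vDash A$ for every state sequence $\bar\sigma$. **Linear nested sequents.** A Gentzen sequent is $\Gamma\vdash\Delta$ with $\Gamma,\Delta$ finite sets of formulae. A linear nested sequent (LNS) is a nonempty finite sequence $\mathcal{G} = \Gamma_0\vdash\Delta_0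 /\!/ \cdots /\!/ \Gamma_n\vdash\Delta_n$ of Gentzen sequents; $\Gamma_i\vdash\Delta_i$ is its $i$-component. Formula interpretation: $f(\Gamma\vdash\Delta) := \bigwedge\Gamma\to\bigvee\Delta$, $f(\Gamma\vdash\Delta /\!/ \mathcal{G}) := \bigwedge\Gamma\to(\bigvee\Delta\lor\mathtt{X}f(\mathcal{G}))$. $\bar\sigma,i\vDash\mathcal{G}$ iff $\bar\sigma,i\vDash f(\mathcal{G})$; $\mathcal{G}$ is valid iff $f(\mathcal{G})$ is valid. **Rules** ($\mathsf{LNS_{LTL}}$). Here $\mathcal{G},\mathcal{H}$ are possibly empty, and the comma is set union (so in ''$\Gamma, A$'' one may have $A\in\Gamma$). Initial rules (no premises): $\mathsf{id}$: $\mathcal{G}/\!/\Gamma,p\vdash p,\Delta/\!/\mathcal{H}$; $\bot\mathsf{L}$: $\mathcal{G}/\!/\Gamma,\bot\vdash\Delta/\!/\mathcal{H}$. Their conclusions are called initial sequents. Logical rules: - ${\to}\mathsf{R}$: from $\mathcal{G}/\!/\Gamma,A\vdash B,\Delta/\!/\mathcal{H}$ infer $\mathcal{G}/\!/\Gamma\vdash A\to B,\Delta/\!/\mathcal{H}$. - ${\to}\mathsf{L}$: from $\mathcal{G}/\!/\Gamma,B\vdash\Delta/\!/\mathcal{H}$ and $\mathcal{G}/\!/\Gamma\vdash A,\Delta/\!/\mathcal{H}$ infer $\mathcal{G}/\!/\Gamma,A\to B\vdash\Delta/\!/\mathcal{H}$. - $\mathtt{X}\mathsf{L}_1$: from $\mathcal{G}/\!/\Gamma\vdash\Delta/\!/\Sigma,A\vdash\Pi/\!/\mathcal{H}$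 infer $\mathcal{G}/\!/\Gamma,\mathtt{X}A\vdash\Delta/\!/\Sigma\vdash\Pi/\!/\mathcal{H}$. - $\mathtt{X}\mathsf{L}_2$: from $\mathcal{G}/\!/\Gamma\vdash\Delta/\!/A\vdash$ infer $\mathcal{G}/\!/\Gamma,\mathtt{X}A\vdash\Delta$. - $\mathtt{X}\mathsf{R}_1$: from $\mathcal{G}/\!/\Gamma\vdash\Delta/\!/\Sigma\vdash A,\Pi/\!/\mathcal{H}$ infer $\mathcal{G}/\!/\Gamma\vdash\mathtt{X}A,\Delta/\!/\Sigma\vdash\Pi/\!/\mathcal{H}$. - $\mathtt{X}\mathsf{R}_2$: from $\mathcal{G}/\!/\Gamma\vdash\Delta/\!/\vdash A$ infer $\mathcal{G}/\!/\Gamma\vdash\mathtt{X}A,\Delta$. - $\mathtt{U}\mathsf{L}_1$: from (left) $\mathcal{G}/\!/\Gamma,B\vdash\Delta/\!/\Sigma\vdash\Pi/\!/\mathcal{H}$ and (right) $\mathcal{G}/\!/\Gamma,A\vdash\Delta/\!/\Sigma,A\,\mathtt{U}\,B\vdash\Pi/\!/\mathcal{H}$ infer $\mathcal{G}/\!/\Gamma,A\,\mathtt{U}\,B\vdash\Delta/\!/\Sigma\vdash\Pi/\!/\mathcal{H}$. - $\mathtt{U}\mathsf{R}_1$: from (left) $\mathcal{G}/\!/\Gamma\vdash A,B,\Delta/\!/\Sigma\vdash\Pi/\!/\mathcal{H}$ and (right) $\mathcal{G}/\!/\Gamma\vdash B,\Delta/\!/\Sigma\vdash A\,\mathtt{U}\,B,\Pi/\!/\mathcal{H}$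 infer $\mathcal{G}/\!/\Gamma\vdash A\,\mathtt{U}\,B,\Delta/\!/\Sigma\vdash\Pi/\!/\mathcal{H}$. - $\mathtt{U}\mathsf{L}_2$: from (left) $\mathcal{G}/\!/\Gamma,B\vdash\Delta$ and (right) $\mathcal{G}/\!/\Gamma,A\vdash\Delta/\!/A\,\mathtt{U}\,B\vdash$ infer $\mathcal{G}/\!/\Gamma,A\,\mathtt{U}\,B\vdash\Delta$. - $\mathtt{U}\mathsf{R}_2$: from (left) $\mathcal{G}/\!/\Gamma\vdash A,B,\Delta$ and (right) $\mathcal{G}/\!/\Gamma\vdash B,\Delta/\!/\vdash A\,\mathtt{U}\,B$ infer $\mathcal{G}/\!/\Gamma\vdash A\,\mathtt{U}\,B,\Delta$. The principal formula of a logical rule is the (occurrence of the) formula explicitly displayed in its conclusion. **Derivations.** A derivation of $\mathcal{G}$ is a possibly infinite tree of LNSs with root $\mathcal{G}$ in which every parent node is the conclusion of a rule whose premises are its children. A path is a finite or infinite sequence of nodes in which each is the parent of the next; a branch is a maximal path starting at the root. **Traces and non-wellfounded proofs.** A trace value of $\mathcal{G}=\Gamma_0\vdash\Delta_0/\!/\cdots/\!/\Gamma_n\vdash\Delta_n$ is a pair $\langle A\,\mathtt{U}\,B,i\rangle$ with $0\le i\le n$ and $A\,\mathtt{U}\,B\in\Gamma_i$. For a rule instance $\mathsf{r}$ with conclusion $\mathcal{G}$ and premise $\mathcal{H}$, $(\langle A\,\mathtt{U}\,B,i\rangle,\langle A\,\mathtt{U}\,B,j\rangle)$ is a trace pair for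 $(\mathcal{G},\mathcal{H})$ iff these are trace values of $\mathcal{G}$ and $\mathcal{H}$ respectively and (1) if $A\,\mathtt{U}\,B$ is not principal in $\mathsf{r}$, then $i=j$; (2) if $A\,\mathtt{U}\,B$ is principal in $\mathsf{r}$, then $j=i+1$ and $\mathcal{H}$ is the right premise of $\mathsf{r}$. It is progressing iff $j=i+1$. A trace along a path $\{\mathcal{G}_i\}_{i}$ is a sequence of trace values $\{\tau_i\}_i$ such that each $(\tau_i,\tau_{i+1})$ is a trace pair for $(\mathcal{G}_i,\mathcal{G}_{i+1})$. A trace along an infinite path is progressing iff infinitely many of its trace pairs are progressing; an infinite path is progressing iff it has a progressing trace. A non-wellfounded proof ($\mathsf{LNS^{\infty}_{LTL}}$-proof) of $\mathcal{G}$ is a derivation of $\mathcal{G}$ in which every leaf is an initial sequent and every infinite branch has a suffix that is a progressing path. **Saturation.** An LNS $\mathcal{G}$ with components $\Gamma_0\vdash\Delta_0,\ldots,\Gamma_n\vdash\Delta_n$ is $i$-saturated ($0\le i\le n$) iff it is not an initial sequent and $\Gamma_i\cup\Delta_i$ contains no formula of the form $\mathtt{X}A$, $A\to B$ or $A\,\mathtt{U}\,B$. $\mathcal{G}$ is saturated iff it is $i$-saturated for each $0\le i<n$ (i.e., for every component other than the last). A derivation satisfies the saturation recurrence property (SRP) iff for every infinite branch $\{\mathcal{G}_i\}_{i\in\mathbb{N}}$ in it, infinitely many $\mathcal{G}_i$ are saturated. *)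

(* Defs.v *)
From HB Require Import structures.
From mathcomp Require Import all_boot finmap.

Set Implicit Arguments.
Unset Strict Implicit.
Unset Printing Implicit Defensive.

Local Open Scope fset_scope.

(* ** Language and semantics *)

Inductive formula (Atm : Type) : Type :=
| Atom of Atm
| Bot
| Imp of formula Atm & formula Atm
| Next of formula Atm
| Until of formula Atm & formula Atm.

Arguments Bot {Atm}.

Definition Neg Atm (A : formula Atm) : formula Atm := Imp A Bot.
Definition Or Atm (A B : formula Atm) : formula Atm := Imp (Neg A) B.
Definition And Atm (A B : formula Atm) : formula Atm := Neg (Imp A (Neg B)).

(* Formulae form a countType whenever atoms do (by encoding into trees), so
   that finite sets of formulae are available as [{fset formula Atm}]. *)
Fixpoint formula_encode Atm (A : formula Atm) : GenTree.tree Atm :=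
  match A with
  | Atom p => GenTree.Leaf p
  | Bot => GenTree.Node 0 [::]
  | Imp B C => GenTree.Node 1 [:: formula_encode B; formula_encode C]
  | Next B => GenTree.Node 2 [:: formula_encode B]
  | Until B C => GenTree.Node 3 [:: formula_encode B; formula_encode C]
  end.

Fixpoint formula_decode Atm (t : GenTree.tree Atm) : option (formula Atm) :=
  match t with
  | GenTree.Leaf p => Some (Atom p)
  | GenTree.Node 0 [::] => Some Bot
  | GenTree.Node 1 [:: t1; t2] =>
      if (formula_decode t1, formula_decode t2) is (Some B, Some C)
      then Some (Imp B C) else None
  | GenTree.Node 2 [:: t1] => omap (@Next Atm) (formula_decode t1)
  | GenTree.Node 3 [:: t1; t2] =>
      if (formula_decode t1, formula_decode t2) is (Some B, Some C)
      then Some (Until B C) else None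
  | _ => None
  end.

Lemma formula_encodeK Atm :
  pcancel (@formula_encode Atm) (@formula_decode Atm).
Proof. by elim=> //= [B -> C ->|B ->|B -> C ->]. Qed.

HB.instance Definition _ (Atm : countType) :=
  Countable.copy (formula Atm) (pcan_type (@formula_encodeK Atm)).

Definition state_sequence (Atm : Type) : Type := nat -> Atm -> Prop.

Fixpoint sat Atm (s : state_sequence Atm) (i : nat) (A : formula Atm) : Prop :=
  match A with
  | Atom p => s i p
  | Bot => False
  | Imp B C => ~ sat s i B \/ sat s i C
  | Next B => sat s i.+1 B
  | Until B C =>
      exists j, [/\ i <= j, sat s j C & forall n, i <= n < j -> sat s n B]
  end.

Definition valid Atm (A : formula Atm) : Prop :=
  forall s : state_sequence Atm, sat s 0 A.

(* ** Linear nested sequents *)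

Definition sequent (Atm : countType) : Type :=
  ({fset formula Atm} * {fset formula Atm})%type.

Notation "Gam |-- Del" := ((Gam, Del) : sequent _)
  (at level 65, no associativity).

Record lns (Atm : countType) : Type := LNS {
  components :> seq (sequent Atm);
  components_neq0 : components != [::]
}.

HB.instance Definition _ (Atm : countType) := [isSub for @components Atm].

(* The empty conjunction is [Neg Bot] and the empty disjunction is [Bot]. *)
Definition BigAnd (Atm : countType) (Gam : {fset formula Atm}) : formula Atm :=
  foldr (@And Atm) (Neg Bot) (enum_fset Gam).
Definition BigOr (Atm : countType) (Del : {fset formula Atm}) : formula Atm :=
  foldr (@Or Atm) Bot (enum_fset Del).

(* The value on the empty list is irrelevant: an [lns] is never empty. *)
Fixpoint interp_seq (Atm : countType) (G : seq (sequent Atm)) : formula Atm :=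
  match G with
  | [::] => Bot
  | [:: S0] => Imp (BigAnd S0.1) (BigOr S0.2)
  | S0 :: G' => Imp (BigAnd S0.1) (Or (BigOr S0.2) (Next (interp_seq G')))
  end.

Definition interp (Atm : countType) (G : lns Atm) : formula Atm :=
  interp_seq (components G).

Definition valid_lns (Atm : countType) (G : lns Atm) : Prop :=
  valid (interp G).

(* [splice G S H] is the linear nested sequent G // S // H, where the contexts
   G and H are possibly empty. *)
Lemma splice_neq0 (T : eqType) (G : seq T) (S : T) (H : seq T) :
  G ++ S :: H != [::].
Proof. by case: G. Qed.

Definition splice (Atm : countType) (G : seq (sequent Atm)) (S : sequent Atm)
  (H : seq (sequent Atm)) : lns Atm := LNS (splice_neq0 G S H).

(* ** Rules *)

Inductive initial (Atm : countType) : lns Atm -> Prop :=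
| rule_id G H Gam Del p :
    initial (splice G (Atom p |` Gam |-- Atom p |` Del) H)
| rule_botL G H Gam Del :
    initial (splice G (Bot |` Gam |-- Del) H).

(* An occurrence of a formula in a linear nested sequent: in the antecedent
   ([OccL i A]) or in the succedent ([OccR i A]) of the i-component. *)
Variant occurrence (Atm : Type) : Type :=
| OccL of nat & formula Atm
| OccR of nat & formula Atm.

(* [rule C o Ps]: C is the conclusion of an instance of a logical rule with
   principal occurrence o and premises Ps, listed from left to right. *)
Inductive rule (Atm : countType) :
  lns Atm -> occurrence Atm -> seq (lns Atm) -> Prop :=
| rule_impR G H Gam Del A B :
    rule (splice G (Gam |-- Imp A B |` Del) H)
      (OccR (size G) (Imp A B))
      [:: splice G (A |` Gam |-- B |` Del) H]
| rule_impL G H Gam Del A B :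
    rule (splice G (Imp A B |` Gam |-- Del) H)
      (OccL (size G) (Imp A B))
      [:: splice G (B |` Gam |-- Del) H;
          splice G (Gam |-- A |` Del) H]
| rule_nextL1 G H Gam Del Sig Pi A :
    rule (splice G (Next A |` Gam |-- Del) ((Sig |-- Pi) :: H))
      (OccL (size G) (Next A))
      [:: splice G (Gam |-- Del) ((A |` Sig |-- Pi) :: H)]
| rule_nextL2 G Gam Del A :
    rule (splice G (Next A |` Gam |-- Del) [::])
      (OccL (size G) (Next A))
      [:: splice G (Gam |-- Del) [:: [fset A] |-- fset0]]
| rule_nextR1 G H Gam Del Sig Pi A :
    rule (splice G (Gam |-- Next A |` Del) ((Sig |-- Pi) :: H))
      (OccR (size G) (Next A))
      [:: splice G (Gam |-- Del) ((Sig |-- A |` Pi) :: H)]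
| rule_nextR2 G Gam Del A :
    rule (splice G (Gam |-- Next A |` Del) [::])
      (OccR (size G) (Next A))
      [:: splice G (Gam |-- Del) [:: fset0 |-- [fset A]]]
| rule_untilL1 G H Gam Del Sig Pi A B :
    rule (splice G (Until A B |` Gam |-- Del) ((Sig |-- Pi) :: H))
      (OccL (size G) (Until A B))
      [:: splice G (B |` Gam |-- Del) ((Sig |-- Pi) :: H);
          splice G (A |` Gam |-- Del) ((Until A B |` Sig |-- Pi) :: H)]
| rule_untilR1 G H Gam Del Sig Pi A B :
    rule (splice G (Gam |-- Until A B |` Del) ((Sig |-- Pi) :: H))
      (OccR (size G) (Until A B))
      [:: splice G (Gam |-- A |` (B |` Del)) ((Sig |-- Pi) :: H);
          splice G (Gam |-- B |` Del) ((Sig |-- Until A B |` Pi) :: H)]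
| rule_untilL2 G Gam Del A B :
    rule (splice G (Until A B |` Gam |-- Del) [::])
      (OccL (size G) (Until A B))
      [:: splice G (B |` Gam |-- Del) [::];
          splice G (A |` Gam |-- Del) [:: [fset Until A B] |-- fset0]]
| rule_untilR2 G Gam Del A B :
    rule (splice G (Gam |-- Until A B |` Del) [::])
      (OccR (size G) (Until A B))
      [:: splice G (Gam |-- A |` (B |` Del)) [::];
          splice G (Gam |-- B |` Del) [:: fset0 |-- [fset Until A B]]].

(* ** Derivations *)

(* A possibly infinite tree is given by its labelling: nodes are addresses
   (sequences of child numbers, the root being [::], the left premise number 0
   and the right premise number 1), and [None] marks addresses outside the
   tree. A node carries its linear nested sequent and, unless it is a leaf, the
   principal occurrence of the rule instance of which it is the conclusion. *)
Definition tree (Atm : countType) : Type :=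
  seq nat -> option (lns Atm * option (occurrence Atm)).

Definition node_lns (Atm : countType) (T : tree Atm) (a : seq nat) :
  option (lns Atm) := omap fst (T a).

Definition is_derivation (Atm : countType) (T : tree Atm) (G : lns Atm) : Prop :=
  node_lns T [::] = Some G /\
  forall a,
    match T a with
    | Some (C, Some o) =>
        exists Ps, rule C o Ps /\
          forall k, node_lns T (rcons a k) = onth Ps k
    | _ => forall k, T (rcons a k) = None
    end.

Definition infinite_path (Atm : countType) (T : tree Atm)
    (b : nat -> seq nat) : Prop :=
  forall n, T (b n) <> None /\ exists k, b n.+1 = rcons (b n) k.

Definition infinite_branch (Atm : countType) (T : tree Atm)
    (b : nat -> seq nat) : Prop :=
  b 0 = [::] /\ infinite_path T b.

(* ** Traces *)

Definition component (Atm : countType) (G : lns Atm) (i : nat) : sequent Atm :=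
  nth (fset0 |-- fset0) G i.

Definition is_trace_value (Atm : countType) (G : lns Atm)
    (t : formula Atm * nat) : Prop :=
  [/\ exists A B, t.1 = Until A B,
      t.2 < size G &
      t.1 \in (component G t.2).1].

(* Trace pairs for a rule instance with conclusion G, principal occurrence o
   and k-th premise H. A trace value stands for an antecedent occurrence, so it
   is principal exactly when that very occurrence is. *)
Definition trace_pair (Atm : countType) (G : lns Atm) (o : occurrence Atm)
    (k : nat) (H : lns Atm) (t t' : formula Atm * nat) : Prop :=
  [/\ is_trace_value G t,
      is_trace_value H t',
      t'.1 = t.1,
      o <> OccL t.2 t.1 -> t'.2 = t.2 &
      o = OccL t.2 t.1 -> t'.2 = t.2.+1 /\ k = 1].

Definition progressing_pair (Atm : Type) (t t' : formula Atm * nat) : Prop :=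
  t'.2 = t.2.+1.

Definition is_trace (Atm : countType) (T : tree Atm) (b : nat -> seq nat)
    (t : nat -> formula Atm * nat) : Prop :=
  forall n, exists G o k H,
    [/\ T (b n) = Some (G, Some o),
        b n.+1 = rcons (b n) k,
        node_lns T (b n.+1) = Some H &
        trace_pair G o k H (t n) (t n.+1)].

Definition infinitely_many (P : nat -> Prop) : Prop :=
  forall m, exists n, m <= n /\ P n.

Definition progressing_path (Atm : countType) (T : tree Atm)
    (b : nat -> seq nat) : Prop :=
  infinite_path T b /\
  exists t, is_trace T b t /\
    infinitely_many (fun n => progressing_pair (t n) (t n.+1)).

Definition is_proof (Atm : countType) (T : tree Atm) (G : lns Atm) : Prop :=
  [/\ is_derivation T G,
      forall a C, T a = Some (C, None) -> initial C &
      forall b, infinite_branch T b ->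
        exists m, progressing_path T (fun n => b (m + n)%N)].

(* ** Saturation *)

Definition decomposable Atm (A : formula Atm) : Prop :=
  match A with
  | Imp _ _ | Next _ | Until _ _ => True
  | _ => False
  end.

Definition i_saturated (Atm : countType) (i : nat) (G : lns Atm) : Prop :=
  ~ initial G /\
  forall A, A \in (component G i).1 `|` (component G i).2 -> ~ decomposable A.

Definition saturated (Atm : countType) (G : lns Atm) : Prop :=
  forall i, i < (size G).-1 -> i_saturated i G.

Definition saturation_recurrence (Atm : countType) (T : tree Atm) : Prop :=
  forall b, infinite_branch T b ->
    infinitely_many (fun n =>
      exists G, node_lns T (b n) = Some G /\ saturated G).

(* Main.v *)
(* Search for a proof by always decomposing a formula of the leftmost component
   that still contains a decomposable one. Decomposition in component i only
   creates smaller formulae in component i and formulae in component i + 1, so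
   on an infinite branch the active component is unbounded: every decomposable
   occurrence is eventually principal, and saturated nodes recur. Along any
   branch, the atoms that ever occur in the antecedent of component i define a
   state sequence. Unless the branch ends in an initial sequent, all occurrences
   are correctly evaluated in it, hence the root is falsified, with one
   exception: an antecedent [A U B] may be false when the right premise is chosen
   forever, and then following it from component to component is a progressing
   trace. As the strategy is fixed, no determinacy argument is needed. *)

Require Import Defs.
From mathcomp Require Import all_boot finmap.
From mathcomp Require Import zify.
From Stdlib Require Import Classical.

Set Implicit Arguments.
Unset Strict Implicit.
Unset Printing Implicit Defensive.

Local Open Scope fset_scope.

Section ProofSearch.
Variable Atm : countType.
(** Side [true] is the antecedent and [false] the succedent; the number is the component index. *)
Local Notation lit := (bool * nat * formula Atm)%type.
Implicit Types (G : lns Atm) (S : sequent Atm) (o : lit) (A B : formula Atm).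

(** * Rules as operations on signed, indexed formulae *)

Definition side (s : bool) S := if s then S.1 else S.2.

Definition on_side (s : bool) (f : {fset formula Atm} -> {fset formula Atm}) S :
  sequent Atm := if s then (f S.1, S.2) else (S.1, f S.2).

Definition occurs o G : bool := o.2 \in side o.1.1 (component G o.1.2).

Definition to_occ o : occurrence Atm :=
  if o.1.1 then OccL o.1.2 o.2 else OccR o.1.2 o.2.

Lemma to_occ_inj : injective to_occ.
Proof. by move=> [[[] i] A] [[[] j] B] //= [-> ->]. Qed.

Lemma set_nth_neq0 (T : eqType) (x0 : T) s n y : set_nth x0 s n y != [::].
Proof. by rewrite -size_eq0 size_set_nth maxnE addSn. Qed.

(** Since [set_nth] extends the list, adding just past the last component opens a new one; this
    merges the two variants of each rule for [Next] and [Until]. *)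
Definition set_component G i S : lns Atm :=
  LNS (set_nth_neq0 (fset0 |-- fset0) (components G) i S).

Definition add o G : lns Atm :=
  set_component G o.1.2
    (on_side o.1.1 (fun X => o.2 |` X) (component G o.1.2)).

Definition del o G : lns Atm :=
  set_component G o.1.2
    (on_side o.1.1 (fun X => X `\ o.2) (component G o.1.2)).

Lemma component_set G i S j :
  component (set_component G i S) j = if j == i then S else component G j.
Proof. by rewrite /component /= nth_set_nth. Qed.

Lemma side_on_side s s' f S :
  side s (on_side s' f S) = if s == s' then f (side s S) else side s S.
Proof. by case: s s' => [] []. Qed.

Lemma occurs_add o o' G : occurs o' (add o G) = (o' == o) || occurs o' G.
Proof.
case: o o' => [[s i] A] [[s' j] B]; rewrite /occurs /= component_set !xpair_eqE.
have [->|_] := eqVneq j i; last by rewrite andbF.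
by rewrite side_on_side; have [->|_] := eqVneq s' s; rewrite ?in_fset1U.
Qed.

Lemma occurs_del o o' G : occurs o' (del o G) = (o' != o) && occurs o' G.
Proof.
case: o o' => [[s i] A] [[s' j] B]; rewrite /occurs /= component_set !xpair_eqE.
have [->|_] := eqVneq j i; last by rewrite andbF.
by rewrite side_on_side; have [->|_] := eqVneq s' s; rewrite ?in_fsetD1.
Qed.

(* One list per premise: the occurrences that replace the principal one. *)
Definition reducts o : seq (seq lit) :=
  let: (s, i, A) := o in
  match s, A with
  | true, Imp A B => [:: [:: (true, i, B)]; [:: (false, i, A)]]
  | false, Imp A B => [:: [:: (true, i, A); (false, i, B)]]
  | _, Next A => [:: [:: (s, i.+1, A)]]
  | true, Until A B =>
      [:: [:: (true, i, B)]; [:: (true, i, A); (true, i.+1, Until A B)]]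
  | false, Until A B =>
      [:: [:: (false, i, A); (false, i, B)];
          [:: (false, i, B); (false, i.+1, Until A B)]]
  | _, _ => [::]
  end.

Definition premises o G : seq (lns Atm) :=
  [seq foldr add (del o G) l | l <- reducts o].

Lemma occurs_premise o o' G l :
  occurs o' (foldr add (del o G) l) = (o' \in l) || (o' != o) && occurs o' G.
Proof.
elim: l => [|o1 l IHl] /=; first by rewrite occurs_del.
by rewrite occurs_add IHl inE orbA.
Qed.

Lemma onth_premises o G k G' :
  onth (premises o G) k = Some G' ->
  exists2 l, onth (reducts o) k = Some l & G' = foldr add (del o G) l.
Proof. by rewrite onth_map; case: onth => //= l [<-]; exists l. Qed.

(** * Agreement with the rules of the calculus *)

Lemma component_splice E S H : component (splice E S H) (size E) = S.
Proof. by rewrite /component /= nth_cat ltnn subnn. Qed.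

Lemma component_spliceS E S H :
  component (splice E S H) (size E).+1 = head (fset0 |-- fset0) H.
Proof. by rewrite /component /= nth_cat ltnNge leqnSn subSnn /= nth0. Qed.

Lemma set_splice E S H S' :
  set_component (splice E S H) (size E) S' = splice E S' H.
Proof.
by apply: val_inj => /=; elim: E => //= S1 E ->.
Qed.

Lemma set_spliceS E S H S' :
  set_component (splice E S H) (size E).+1 S' = splice E S (S' :: behead H).
Proof.
by apply: val_inj => /=; elim: E => [|S1 E /= -> //] /=; case: H.
Qed.

Lemma occurs_size o G : occurs o G -> o.1.2 < size G.
Proof.
rewrite /occurs /component; have [//|le_Gi] := ltnP.
by rewrite nth_default // /side; case: o.1.1; rewrite in_fset0.
Qed.

Lemma occurs_splice o G : occurs o G ->
  exists E S H, [/\ G = splice E S H, o.1.2 = size E & o.2 \in side o.1.1 S].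
Proof.
move=> oG; have lt_iG := occurs_size oG.
exists (take o.1.2 G), (component G o.1.2), (drop o.1.2.+1 G); split=> //.
  by apply: val_inj; rewrite /= -drop_nth // cat_take_drop.
by rewrite size_takel // ltnW.
Qed.

(** The comma being union, the context may or may not keep the principal formula; the search always
    uses the context without it, so that each step consumes its formula. *)
Lemma rule_premises o G :
  occurs o G -> decomposable o.2 -> rule G (to_occ o) (premises o G).
Proof.
case: o => [[s i] A] /occurs_splice[E [[Gam Del] [H [-> /= -> AS]]]].
have nextE := (component_spliceS, component_splice, set_splice, set_spliceS).
case: s AS; case: A => [||A B|A|A B] //= AS _;
  rewrite /premises /= /add /del /= !nextE /= /on_side /=;
  rewrite -{1}(fsetD1K AS).
- exact: rule_impL.
- case: H => [|[Sig Pi] H] /=; rewrite ?fsetU0;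
    [exact: rule_nextL2|exact: rule_nextL1].
- case: H => [|[Sig Pi] H] /=; rewrite ?fsetU0;
    [exact: rule_untilL2|exact: rule_untilL1].
- exact: rule_impR.
- case: H => [|[Sig Pi] H] /=; rewrite ?fsetU0;
    [exact: rule_nextR2|exact: rule_nextR1].
- case: H => [|[Sig Pi] H] /=; rewrite ?fsetU0;
    [exact: rule_untilR2|exact: rule_untilR1].
Qed.

Lemma initial_bot G i : occurs (true, i, Bot) G -> initial G.
Proof.
case/occurs_splice=> E [[Gam Del] [H [-> _ /= Gam_bot]]].
by rewrite -(fsetD1K Gam_bot); apply: rule_botL.
Qed.

Lemma initial_atom G i p :
  occurs (true, i, Atom p) G -> occurs (false, i, Atom p) G -> initial G.
Proof.
case/occurs_splice=> E [[Gam Del] [H [-> /= -> Gam_p]]].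
rewrite /occurs component_splice /= => Del_p.
by rewrite -(fsetD1K Gam_p) -(fsetD1K Del_p); apply: rule_id.
Qed.

(** * The search strategy *)

Definition decomposableb A : bool :=
  match A with Atom _ | Bot => false | _ => true end.

Lemma decomposableP A : reflect (decomposable A) (decomposableb A).
Proof. by case: A => *; constructor. Qed.

Definition lits G : seq lit :=
  undup ([seq (true, i, A) | i <- iota 0 (size G), A <- (component G i).1] ++
         [seq (false, i, A) | i <- iota 0 (size G), A <- (component G i).2]).

Lemma mem_lits G o : (o \in lits G) = occurs o G.
Proof.
rewrite mem_undup mem_cat; apply/idP/idP.
  by case/orP => /allpairsPdep[i [A [_ ? ->]]].
move=> oG; have := occurs_size oG; case: o oG => [[s i] A] /= AG lt_i.
apply/orP; case: s AG => AG; [left|right]; apply/allpairsPdep;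
  by exists i, A; rewrite mem_iota.
Qed.

Definition initialb G : bool :=
  has (fun o => o.1.1 &&
         match o.2 with
         | Bot => true
         | Atom p => occurs (false, o.1.2, Atom p) G
         | _ => false
         end) (lits G).

Lemma initialP G : reflect (initial G) (initialb G).
Proof.
apply: (iffP hasP) => [[[[[] i] [p||||]]] //= | ].
- by rewrite mem_lits; apply: initial_atom.
- by rewrite mem_lits => /initial_bot.
case=> [E H Gam Del p|E H Gam Del].
- exists (true, size E, Atom p); rewrite ?mem_lits /occurs /= component_splice;
    by rewrite /= fset1U1.
- exists (true, size E, Bot); rewrite ?mem_lits /occurs //=.
  by rewrite component_splice /= fset1U1.
Qed.

(** [None] means either an initial sequent, where the branch closes, or a stuck one with nothing to
    decompose. Sorting by component index puts a leftmost candidate first. *)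
Definition principal G : option lit :=
  if initialb G then None else
  ohead (sort (relpre (fun o => o.1.2) leq)
           [seq o <- lits G | decomposableb o.2]).

Lemma principal_Some G o : principal G = Some o ->
  [/\ ~~ initialb G, occurs o G, decomposableb o.2 &
      forall o', occurs o' G -> decomposableb o'.2 -> o.1.2 <= o'.1.2].
Proof.
rewrite /principal; case: ifP => // _.
set r := relpre _ _; set s := filter _ _ => head_o.
have mem_s o' : (o' \in sort r s) = occurs o' G && decomposableb o'.2.
  by rewrite mem_sort mem_filter mem_lits andbC.
have r_trans : transitive r by move=> ? ? ?; apply: leq_trans.
have: sorted r (sort r s) by apply: sort_sorted => ? ?; apply: leq_total.
case: (sort r s) head_o mem_s => //= _ s' [->] mem_s r_s.
have /andP[oG dec_o] : occurs o G && decomposableb o.2.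
  by rewrite -mem_s mem_head.
split=> // o' o'G dec_o'.
have := mem_s o'; rewrite o'G dec_o' inE => /orP[/eqP->//|].
exact: (allP (order_path_min r_trans r_s)).
Qed.

Lemma principal_None G o :
  ~~ initialb G -> principal G = None -> occurs o G -> ~~ decomposableb o.2.
Proof.
rewrite /principal => /negPf-> head_None; rewrite -mem_lits => oG.
apply/negP => dec_o; move: head_None.
set r := relpre _ _; set s := filter _ _.
have : o \in sort r s by rewrite mem_sort mem_filter dec_o.
by case: sort.
Qed.

(** * Termination inside a bounded set of components *)

Fixpoint fsize A : nat :=
  match A with
  | Atom _ | Bot => 0
  | Imp B C | Until B C => (fsize B + fsize C).+1
  | Next B => (fsize B).+1
  end.

(** Size minus component index strictly decreases; the sums avoid truncated subtraction. *)
Lemma reductsP o k l : onth (reducts o) k = Some l ->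
  size l <= 2 /\
  forall o', o' \in l ->
    o'.1.2 <= o.1.2.+1 /\ fsize o'.2 + o.1.2 < fsize o.2 + o'.1.2.
Proof.
have two (T : eqType) (P : T -> Prop) (x y : T) :
    P x -> P y -> forall z, z \in [:: x; y] -> P z.
  by move=> Px Py z; rewrite !inE => /orP[] /eqP->.
have one (T : eqType) (P : T -> Prop) (x : T) :
    P x -> forall z, z \in [:: x] -> P z by move=> Px z; rewrite inE => /eqP->.
by case: o => [[[] i] [p||A B|A|A B]];
   case: k => [|[|k]] /=; rewrite ?onth0n //; case=> <-; split=> //;
   (apply: two || apply: one); split=> //=; lia.
Qed.

(* Base 3 exceeds the number of reducts in a premise, and the factor
   [3 ^ (K - i)] pays for the copy of an [Until] moved one component to the
   right. *)
Definition weight K o : nat :=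
  if o.1.2 <= K then 3 ^ (fsize o.2 + (K - o.1.2)) else 0.

Definition total K G : nat := \sum_(o <- lits G) weight K o.

Lemma leq_sum_subset (I : eqType) (s s' : seq I) (F : I -> nat) :
  uniq s -> uniq s' -> {subset s <= s'} ->
  \sum_(i <- s) F i <= \sum_(i <- s') F i.
Proof. by apply: uniq_sub_le_big => // m n; apply: leq_addr. Qed.

(** Only an inequality, because the added occurrence may already be present. *)
Lemma total_add K o G : total K (add o G) <= weight K o + total K G.
Proof.
have [oG|oG] := boolP (occurs o G).
  apply: leq_trans (leq_addl _ _); apply: leq_sum_subset; rewrite ?undup_uniq //.
  by move=> o'; rewrite !mem_lits occurs_add => /orP[/eqP->|].
have -> : (weight K o + total K G)%N = \sum_(o' <- o :: lits G) weight K o'.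
  by rewrite big_cons.
apply: leq_sum_subset; rewrite /= ?undup_uniq ?mem_lits ?oG //.
by move=> o'; rewrite inE !mem_lits occurs_add.
Qed.

Lemma total_del K o G :
  occurs o G -> weight K o + total K (del o G) <= total K G.
Proof.
rewrite -mem_lits => oG; rewrite /total [leqRHS](big_rem o) //=.
rewrite leq_add2l.
apply: leq_sum_subset; rewrite ?rem_uniq ?undup_uniq //.
by move=> o'; rewrite mem_rem_uniq ?undup_uniq // inE !mem_lits occurs_del.
Qed.

Lemma sum_weight_reducts K o k l : o.1.2 <= K ->
  onth (reducts o) k = Some l -> \sum_(o' <- l) weight K o' < weight K o.
Proof.
move=> le_oK /reductsP[size_l red_l].
(* Beyond [K] a reduct weighs nothing; otherwise its exponent drops, so it weighs at most a third of
   [o]. *)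
have weight3 o' : o' \in l -> weight K o' * 3 <= weight K o.
  case/red_l=> _; rewrite /weight le_oK; case: ifP => // le_o'K lt_o'o.
  by rewrite -expnSr leq_exp2l //; lia.
have w_gt0 : 0 < weight K o by rewrite /weight le_oK expn_gt0.
case: l size_l weight3 {red_l} => [|o1 [|o2 [|//]]] _ w3.
- by rewrite big_nil.
- by rewrite big_seq1; have := w3 o1 (mem_head _ _); lia.
- rewrite big_cons big_seq1; have := w3 o1 (mem_head _ _).
  by have := w3 o2; rewrite !inE eqxx orbT => /(_ isT); lia.
Qed.

Lemma total_premise K o G k G' : occurs o G -> o.1.2 <= K ->
  onth (premises o G) k = Some G' -> total K G' < total K G.
Proof.
move=> oG le_oK /onth_premises[l l_red ->].
have := sum_weight_reducts le_oK l_red; have := total_del K oG.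
suff: total K (foldr add (del o G) l)
      <= \sum_(o' <- l) weight K o' + total K (del o G) by lia.
elim: {l_red}l => [|o' l IHl] /=; first by rewrite big_nil.
by rewrite big_cons; have := total_add K o' (foldr add (del o G) l); lia.
Qed.

(** The sequent can grow only when the principal occurrence lies in its last component. *)
Lemma size_premise o G k G' : occurs o G ->
  onth (premises o G) k = Some G' -> size G' <= maxn (size G) o.1.2.+2.
Proof.
move=> oG /onth_premises[l /reductsP[_ red_l] ->].
elim: l red_l => [|o' l IHl] red_l /=.
  by rewrite size_set_nth; have := occurs_size oG; lia.
rewrite size_set_nth; have [le_o' _] := red_l _ (mem_head _ _).
have {}/IHl : forall x, x \in l ->
    x.1.2 <= o.1.2.+1 /\ fsize x.2 + o.1.2 < fsize o.2 + x.1.2.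
  by move=> x lx; apply: red_l; rewrite inE lx orbT.
by lia.
Qed.

(** * Semantics *)

Definition holds (s : state_sequence Atm) o : Prop :=
  if o.1.1 then sat s o.1.2 o.2 else ~ sat s o.1.2 o.2.

(** The arbitrary start [i] lets the induction over components advance the state by one each
    time. *)
Lemma not_sat_interp_seq s i (E : seq (sequent Atm)) :
  (forall b j A, A \in side b (nth (fset0 |-- fset0) E j) ->
     holds s (b, (i + j)%N, A)) ->
  ~ sat s i (interp_seq E).
Proof.
elim: E i => [|[Gam Del] E IHE] i E_s //=.
have and_s : sat s i (BigAnd Gam).
  have: {in enum_fset Gam, forall A, sat s i A}.
    by move=> A AG; have := E_s true 0 A AG; rewrite addn0.
  rewrite /BigAnd; elim: (enum_fset Gam) => /= [_|A r IHr r_s].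
    by left=> -[].
  have sA := r_s _ (mem_head _ _).
  have {}IHr : sat s i (foldr (@And Atm) (Neg Bot) r).
    by apply: IHr => B rB; apply: r_s; rewrite inE rB orbT.
  by left; tauto.
have or_s : ~ sat s i (BigOr Del).
  have: {in enum_fset Del, forall A, ~ sat s i A}.
    by move=> A AG; have := E_s false 0 A AG; rewrite /holds /= addn0.
  rewrite /BigOr; elim: (enum_fset Del) => [_ []|A r IHr r_s] /=.
  have sA := r_s _ (mem_head _ _).
  have {}IHr : ~ sat s i (foldr (@Or Atm) Bot r).
    by apply: IHr => B rB; apply: r_s; rewrite inE rB orbT.
  by tauto.
have {IHE} next_s : ~ sat s i.+1 (interp_seq E).
  by apply: IHE => b j A AE; rewrite addSnnS; apply: (E_s b j.+1).
by case: E next_s {E_s} => [|S E] /= next_s; tauto.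
Qed.

Lemma valid_not_falsified s G :
  valid_lns G -> (forall o, occurs o G -> holds s o) -> False.
Proof.
move=> /(_ s) G_s G_occ; apply: (@not_sat_interp_seq s 0 _ _ G_s) => b j A.
exact: (G_occ (b, j, A)).
Qed.

(** * Runs of the search and their models *)

(* A run that gets stuck is prolonged by repeating its last member; leaves and
   infinite branches of the search are then treated alike. *)
Definition run (g : nat -> lns Atm) (k : nat -> nat) : Prop :=
  forall n,
    if principal (g n) is Some o
    then onth (premises o (g n)) (k n) = Some (g n.+1)
    else ~~ initialb (g n) /\ g n.+1 = g n.

(** A trace keeps its formula [U], so only the component [t n] varies; time is counted from [m], and
    premise 1 is the right one. *)
Definition trace_from (g : nat -> lns Atm) (k : nat -> nat) U m
    (t : nat -> nat) : Prop :=
  forall n, let o := (true, t n, U) in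
    occurs o (g (m + n)%N) /\
    if principal (g (m + n)%N) == Some o
    then k (m + n)%N = 1 /\ t n.+1 = (t n).+1 else t n.+1 = t n.

Definition has_progressing_trace (g : nat -> lns Atm) (k : nat -> nat) : Prop :=
  exists A B m t, trace_from g k (Until A B) m t /\
    infinitely_many (fun n =>
      principal (g (m + n)%N) = Some (true, t n, Until A B)).

Lemma mem_second (T : eqType) (x y : T) : y \in [:: x; y].
Proof. by rewrite !inE eqxx orbT. Qed.

(** * Unboundedness, fairness and saturation along a run *)

Section Run.
Variables (g : nat -> lns Atm) (k : nat -> nat).
Hypothesis g_run : run g k.

Lemma run_not_initial n : ~~ initialb (g n).
Proof.
have := g_run n; case def_o: (principal (g n)) => [o|]; last by case.
by case: (principal_Some def_o).
Qed.

Lemma run_persist n o : occurs o (g n) -> principal (g n) <> Some o ->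
  occurs o (g n.+1).
Proof.
have := g_run n; case: principal => [o'|[_ ->] //] /onth_premises[l _ ->].
move=> oG neq_o; rewrite occurs_premise oG andbT; apply/orP; right.
by apply/eqP=> eq_o; rewrite eq_o in neq_o.
Qed.

Lemma run_persist_atomic n m o : n <= m -> ~~ decomposableb o.2 ->
  occurs o (g n) -> occurs o (g m).
Proof.
move=> /subnKC<- atomic_o og; elim: (m - n) => [|d IHd]; first by rewrite addn0.
rewrite addnS; apply: run_persist IHd _ => /principal_Some[_ _ dec_o _].
by rewrite dec_o in atomic_o.
Qed.

Lemma run_reducts n o : principal (g n) = Some o ->
  exists2 l, onth (reducts o) (k n) = Some l &
    forall o', o' \in l -> occurs o' (g n.+1).
Proof.
move=> def_o; have := g_run n; rewrite def_o => /onth_premises[l lP ->].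
by exists l => // o' lo'; rewrite occurs_premise lo'.
Qed.

(** While the principal occurrence stays in components up to [K], the total weight for [K]
    decreases, so the run eventually leaves them or gets stuck. *)
Lemma principal_unbounded m K : exists2 n, m <= n &
  if principal (g n) is Some o then K < o.1.2 else true.
Proof.
have [N] := ubnP (total K (g m)); elim: N m => // N IHN m; rewrite ltnS => le_N.
case def_o: (principal (g m)) (g_run m) => [o|]; last first.
  by move=> _; exists m; rewrite ?def_o.
have [gt_o _|le_o o_step] := ltnP K o.1.2; first by exists m; rewrite ?def_o.
have [_ og _ _] := principal_Some def_o.
have [|n lt_mn nP] := IHN m.+1.
  by have := total_premise og le_o o_step; lia.
by exists n => //; apply: ltnW.
Qed.

(** Until it is principal, [o] persists, and the leftmost strategy cannot move past its component;
    by unboundedness it must be chosen. *)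
Lemma run_fair n o : occurs o (g n) -> decomposableb o.2 ->
  exists2 m, n <= m & principal (g m) = Some o.
Proof.
move=> og dec_o; have [m /subnKC<-] := principal_unbounded n o.1.2.
move: (m - n) => d; elim: d n og {m} => [|d IHd] n og.
  rewrite addn0; case def_o: principal => [o'|] nP.
    by have [_ _ _ /(_ o og dec_o)] := principal_Some def_o; lia.
  by have := principal_None (run_not_initial n) def_o og; rewrite dec_o.
rewrite addnS -addSn => nP.
have [/eqP def_o|/eqP not_o] := boolP (principal (g n) == Some o).
  by exists n.
have [m lt_nm mP] := IHd _ (run_persist og not_o) nP.
by exists m => //; apply: ltnW.
Qed.

Lemma run_saturated m :
  (forall n, principal (g n) <> None) -> exists n, m <= n /\ saturated (g n).
Proof.
(* It suffices that the principal occurrence lies in the last component: being leftmost, it leaves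
   nothing decomposable in the earlier ones. *)
move=> g_some; suff [n le_mn]: exists2 n, m <= n &
    if principal (g n) is Some o then size (g n) <= o.1.2.+1 else true.
  case def_o: principal (g_some n) => [o|] // _ le_o; exists n; split=> // i lt_i.
  have [/initialP not_init _ _ min_o] := principal_Some def_o.
  split=> // A; rewrite in_fsetU => A_i /decomposableP dec_A.
  have : exists b, occurs (b, i, A) (g n).
    by case/orP: A_i; [exists true|exists false].
  by case=> b /min_o /(_ dec_A) /=; lia.
(* The active component must exceed the current size, but the size cannot grow before the last
   component becomes active. *)
have [n /subnKC<-] := principal_unbounded m (size (g m)).
move: (n - m) => d; elim: d m {n} => [|d IHd] m.
  rewrite addn0 => nP; exists m => //.
  by case: principal nP => // o; lia.
rewrite addnS -addSn => nP; case def_o: (principal (g m)) => [o|]; last first.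
  by exists m; rewrite ?def_o.
have [le_m|lt_m] := leqP (size (g m)) o.1.2.+1.
  by exists m; rewrite ?def_o.
have := g_run m; rewrite def_o => o_step.
have [_ og _ _] := principal_Some def_o.
have le_size : size (g m.+1) <= size (g m).
  by have := size_premise og o_step; lia.
have [|n lt_mn ?] := IHd m.+1; last by exists n => //; apply: ltnW.
by case: principal nP => // o'; lia.
Qed.

(** * The countermodel of a run without progressing trace *)

Section Countermodel.
Hypothesis no_trace : ~ has_progressing_trace g k.

Definition run_model : state_sequence Atm :=
  fun i p => exists n, occurs (true, i, Atom p) (g n).

(** Follows [U] from component [i] at time [n] for [d] steps, moving right whenever the followed
    occurrence is principal. *)
Fixpoint trace_position U n i d : nat :=
  if d is d'.+1 then
    let j := trace_position U n i d' in
    if principal (g (n + d')%N) == Some (true, j, U) then j.+1 else j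
  else i.

Lemma sat_untilE (s : state_sequence Atm) i A B :
  sat s i (Until A B) <->
  sat s i B \/ sat s i A /\ sat s i.+1 (Until A B).
Proof.
split=> /= [[j [le_ij sB sA]]|[sB|[sA [j [lt_ij sB sA']]]]].
- move: le_ij; rewrite leq_eqVlt => /predU1P[->|lt_ij]; [by left|right].
  split; first by apply: sA; rewrite leqnn.
  exists j; split=> // n /andP[lt_in lt_nj].
  by apply: sA; rewrite lt_nj (ltnW lt_in).
- by exists i; split=> // n; rewrite ltnNge andbN.
- exists j; split; rewrite ?(ltnW lt_ij) // => n /andP[].
  rewrite leq_eqVlt => /predU1P[<- //|lt_in lt_nj].
  by apply: sA'; rewrite lt_in.
Qed.

(** If the [Until] were false, the left premise could never be chosen, as it would make [B] true;
    the right one makes [A] true, so the [Until] is false one state later too. Following it forever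
    gives a trace, which progresses by fairness. *)
Lemma run_model_until A B i n :
  (forall i n, occurs (true, i, A) (g n) -> sat run_model i A) ->
  (forall i n, occurs (true, i, B) (g n) -> sat run_model i B) ->
  occurs (true, i, Until A B) (g n) -> sat run_model i (Until A B).
Proof.
set U := Until A B => sA sB Ug; apply: NNPP => not_U; apply: no_trace.
exists A, B, n, (trace_position U n i).
pose t := trace_position U n i.
have t_inv d : occurs (true, t d, U) (g (n + d)%N) /\ ~ sat run_model (t d) U.
  elim: d => [|d]; first by rewrite addn0.
  rewrite addnS /t /= -/(t d); set j := t d => -[jg not_Uj].
  case: eqP => [def_j|]; last by move=> not_j; split=> //; apply: run_persist.
  have [l] := run_reducts def_j; have := proj2 (sat_untilE run_model j A B).
  case: (k _) => [|[|k']] /= U_j; rewrite ?onth0n // => -[<-] lg.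
    by case: not_Uj; apply: U_j; left; apply/sB/lg/mem_head.
  split; first by apply/lg/mem_second.
  move=> U_j1; case: not_Uj; apply: U_j; right; split=> //.
  by apply/sA/lg/mem_head.
split=> [d /=|m]; rewrite -/t.
  have [jg not_Uj] := t_inv d; split=> //; rewrite -/(t d).
  case: eqP => // def_j; split=> //; have [l] := run_reducts def_j.
  case: (k _) => [|[|k']] /=; rewrite ?onth0n // => -[<-] lg.
  by case: not_Uj; apply/sat_untilE; left; apply/sB/lg/mem_head.
(* Fairness gives a time when the occurrence at [t m] is principal; the position does not change
   before the first such time, so the trace progresses there. *)
have [jg _] := t_inv m; have [p] := run_fair jg isT.
move/subnKC=> <-; move: (p - _) => d; elim: d m {p jg} => [|d IHd] m.
  by rewrite addn0 => def_j; exists m.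
have [def_j _|not_j] := eqVneq (principal (g (n + m)%N)) (Some (true, t m, U)).
  by exists m.
have -> : (n + m + d.+1 = n + m.+1 + d)%N by lia.
have t_m : t m.+1 = t m by rewrite /t /= -/(t m) (negPf not_j).
by rewrite -{1}t_m => /IHd[p [lt_mp ?]]; exists p; split=> //; apply: ltnW.
Qed.

Lemma run_model_holds o n : occurs o (g n) -> holds run_model o.
Proof.
case: o => [[b i] A] /=.
suff: (forall i n, occurs (true, i, A) (g n) -> sat run_model i A) /\
      (forall i n, occurs (false, i, A) (g n) -> ~ sat run_model i A).
  by case=> sT sF; case: b => /=; [apply: sT|apply: sF].
have reduct b' j C m : occurs (b', j, C) (g m) -> decomposableb C ->
    exists p l, onth (reducts (b', j, C)) p = Some l /\
      exists q, forall o', o' \in l -> occurs o' (g q).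
  move=> Cg dec_C; have [q _ /run_reducts[l lP lg]] := run_fair Cg dec_C.
  by exists (k q), l; split=> //; exists q.+1.
elim: A {b i n} => [p||A [sA nA] B [sB nB]|A [sA nA]|A [sA nA] B [sB nB]].
- split=> [i n pg|i n pg [m pg']]; first by exists n.
  (* Atoms persist, so at the later of the two times the atom would be on both sides. *)
  have /negP := run_not_initial (maxn n m); apply; apply/initialP.
  apply: (@initial_atom _ i p).
    exact: run_persist_atomic (leq_maxr n m) _ pg'.
  exact: run_persist_atomic (leq_maxl n m) _ pg.
- split=> i n botg; last by case.
  by have /negP := run_not_initial n; case; apply/initialP/initial_bot/botg.
- split=> i n /reduct/(_ isT)[p [l [lP [q lg]]]]; case: p lP => [|[|p]] /=;
    rewrite ?onth0n //; case=> def_l; rewrite -{}def_l in lg.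
  + by right; apply/sB/lg/mem_head.
  + by left; apply/nA/lg/mem_head.
  + have {}sA := sA _ _ (lg _ (mem_head _ _)).
    by have := nB _ _ (lg (false, i, B) (mem_second _ _)); tauto.
- split=> i n /reduct/(_ isT)[p [l [lP [q lg]]]]; case: p lP => [|p] /=;
    rewrite ?onth0n //; case=> def_l; rewrite -{}def_l in lg.
  + by apply/sA/lg/mem_head.
  + by apply/nA/lg/mem_head.
- split=> i n; first exact: run_model_until.
  (* Induction on the distance [d] to the state where [B] holds. At distance 0 both premises refute
     [B]; otherwise the left one refutes [A] and the right one moves the [Until] a state closer. *)
  move=> Ug [j [/subnKC<-]]; move: (j - i) => d;
    elim: d i n Ug {j} => [|d IHd] i n;
    move=> /reduct/(_ isT)[p [l [lP [q lg]]]] sBj sAj; case: p lP => [|[|p]] /=;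
    rewrite ?onth0n //; case=> def_l; rewrite -{}def_l in lg.
  + by apply: nB (lg _ (mem_second _ _)) _; rewrite addn0 in sBj.
  + by apply: nB (lg _ (mem_head _ _)) _; rewrite addn0 in sBj.
  + by apply: nA (lg _ (mem_head _ _)) _; apply: sAj; rewrite leqnn; lia.
  + apply: IHd (lg _ (mem_second _ _)) _ _; rewrite addSnnS // => m.
    by case/andP=> lt_im ?; apply: sAj; rewrite (ltnW lt_im).
Qed.

End Countermodel.

Lemma valid_run_trace : valid_lns (g 0) -> has_progressing_trace g k.
Proof.
move=> valid_g0; apply: NNPP => no_trace.
by apply: (valid_not_falsified valid_g0) => o; apply: run_model_holds.
Qed.

End Run.

(** * The search tree *)

Definition label G : lns Atm * option (occurrence Atm) :=
  (G, omap to_occ (principal G)).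

(** Recursion on the address defines a possibly infinite tree without corecursion. *)
Fixpoint search G (a : seq nat) : option (lns Atm * option (occurrence Atm)) :=
  if a is k :: a' then
    obind (fun o => obind (fun G' => search G' a') (onth (premises o G) k))
          (principal G)
  else Some (label G).

Lemma search_label G a x : search G a = Some x -> x = label x.1.
Proof.
elim: a G => [|k a IHa] G /=; first by case=> <-.
by case: principal => //= o; case: onth => //= G' /IHa.
Qed.

Lemma search_rcons G a k :
  search G (rcons a k) = obind (fun x => search x.1 [:: k]) (search G a).
Proof.
elim: a G => [|k' a IHa] G //=.
by case: principal => //= o; case: onth => //= G'; apply: IHa.
Qed.

Lemma search1 G k :
  search G [:: k] =
  obind (fun o => omap label (onth (premises o G) k)) (principal G).
Proof. by rewrite /=; case: principal => //= o; case: onth. Qed.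

Lemma search_derivation G : is_derivation (search G) G.
Proof.
split=> // a; case def_x: (search G a) => [x|]; last first.
  by move=> k; rewrite search_rcons def_x.
rewrite (search_label def_x) /label.
case def_o: (principal x.1) => [o|] /=; last first.
  by move=> k; rewrite search_rcons def_x /= def_o.
have [_ ox dec_o _] := principal_Some def_o.
exists (premises o x.1); split; first exact/rule_premises/decomposableP.
move=> k; rewrite /node_lns search_rcons def_x [obind _ _]search1 def_o /=.
by case: onth.
Qed.

(** * Leaves and infinite branches as runs *)

Lemma run_cons G o k G' g ks :
  principal G = Some o -> onth (premises o G) k = Some G' ->
  run g ks -> g 0 = G' ->
  run (fun n => if n is n'.+1 then g n' else G)
      (fun n => if n is n'.+1 then ks n' else k).
Proof.
by move=> def_o step g_run def_G' [|n]; rewrite ?def_o ?def_G' //; apply: g_run.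
Qed.

Lemma leaf_run G a C : search G a = Some (C, None) -> ~~ initialb C ->
  exists g ks N, [/\ run g ks, g 0 = G &
    forall n, N <= n -> principal (g n) = None].
Proof.
elim: a G => [|k a IHa] G /=.
  case=> <-; case def_o: principal => [//|] _ not_init.
  by exists (fun=> G), (fun=> 0), 0; split=> // n; rewrite def_o.
case def_o: (principal G) => [o|] //=; case step: onth => [G'|] //= {}/IHa IHa.
move=> {}/IHa[g [ks [N [g_run g0 g_end]]]].
exists (fun n => if n is n'.+1 then g n' else G),
  (fun n => if n is n'.+1 then ks n' else k), N.+1.
split=> //; first exact: run_cons def_o step g_run g0.
by case=> // n; apply: g_end.
Qed.

(** A non-initial leaf would give a run that is eventually stuck, whereas a progressing trace needs
    principal occurrences forever. *)
Lemma search_leaf G a C :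
  valid_lns G -> search G a = Some (C, None) -> initial C.
Proof.
move=> valid_G leaf; apply/initialP/contraT=> /(leaf_run leaf)[g [ks [N]]].
case=> g_run g0 g_end; rewrite -g0 in valid_G.
have [A [B [m [t [_ prog]]]]] := valid_run_trace g_run valid_G.
have [n [le_Nn]] := prog N.
by rewrite g_end // (leq_trans le_Nn) ?leq_addl.
Qed.

Lemma path_run G b : infinite_path (search G) b ->
  exists g ks, [/\ run g ks,
    forall n, search G (b n) = Some (label (g n)),
    forall n, b n.+1 = rcons (b n) (ks n) &
    forall n, principal (g n) <> None].
Proof.
(* The defaults [G] and [0] are never reached: every address on the path is a node, and [b n.+1] is
   nonempty, ending in the premise number. *)
move=> b_path; exists (fun n => odflt G (omap fst (search G (b n)))),
  (fun n => last 0 (b n.+1)).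
set g := fun n => _; set ks := fun n => _.
have b_g n : search G (b n) = Some (label (g n)).
  rewrite /g; have [] := b_path n.
  by case def_x: search => [x|] // _ _; rewrite {1}(search_label def_x).
have b_ks n : b n.+1 = rcons (b n) (ks n).
  by rewrite /ks; have [_ [k ->]] := b_path n; rewrite last_rcons.
have g_step n : obind (fun o => omap label (onth (premises o (g n)) (ks n)))
    (principal (g n)) = Some (label (g n.+1)).
  by rewrite -search1 -b_g b_ks search_rcons b_g.
split=> // n; have := g_step n; case: principal => //= o.
by case: onth => //= G' [->].
Qed.

Lemma search_progressing G b : valid_lns G -> infinite_branch (search G) b ->
  exists m, progressing_path (search G) (fun n => b (m + n)%N).
Proof.
move=> valid_G [b0 b_path].
have [g [ks [g_run b_g b_ks g_some]]] := path_run b_path.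
have g0 : g 0 = G by have := b_g 0; rewrite b0 => -[].
rewrite -{}g0 in valid_G.
have [A [B [m [t [t_trace prog]]]]] := valid_run_trace g_run valid_G.
exists m; split=> [n|]; first by rewrite addnS; apply: b_path.
exists (fun n => (Until A B, t n)); split=> [n|p]; last first.
  have [n [le_pn def_n]] := prog p; exists n; split=> //.
  by have [_] := t_trace n; rewrite def_n eqxx => -[].
have tv p : is_trace_value (g (m + p)%N) (Until A B, t p).
  by have [/[dup] /occurs_size ? ?] := t_trace p; split=> //; exists A, B.
case def_o: (principal (g (m + n)%N)) => [o|]; last by case: (g_some _ def_o).
exists (g (m + n)%N), (to_occ o), (ks (m + n)%N), (g (m + n.+1)%N).
rewrite /node_lns !b_g /= /label def_o addnS; split=> //; split=> //.
- by have := tv n.+1; rewrite addnS.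
- have [_] := t_trace n; rewrite def_o; case: eqP => [[->]|//] _.
  by move=> /(_ erefl).
- have [_] := t_trace n; rewrite def_o => + eq_o.
  by rewrite (@to_occ_inj o (true, t n, Until A B) eq_o) eqxx => -[].
Qed.

Lemma search_saturation_recurrence G : saturation_recurrence (search G).
Proof.
move=> b [_ /path_run[g [ks [g_run b_g _ g_some]]]] m.
have [n [le_mn sat_n]] := run_saturated g_run m g_some.
by exists n; split=> //; exists (g n); rewrite /node_lns b_g.
Qed.

End ProofSearch.

Theorem theorem4p7 (Atm : countType)
    (denumerable : exists e : nat -> Atm, bijective e) (G : lns Atm) :
  valid_lns G ->
  exists T : tree Atm, is_proof T G /\ saturation_recurrence T.
Proof.
move=> valid_G; exists (search G); split;
  last exact: search_saturation_recurrence.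
split; first exact: search_derivation.
- by move=> a C; apply: search_leaf.
- by move=> b; apply: search_progressing.
Qed.
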